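(* Let $n\in\mathbb N$, $T\in(0,\infty]$, and let $H_S\in\mathbb C^{n\times n}$ be Hermitian with rational Bohr spectrum up to a global constant, i.e. there exists a real $r>0$ such that $\sigma(\operatorname{ad}_{H_S})\subseteq r\mathbb Z$. Then $\overline{\mathsf{TO}(H_S,T)}=\overline{\mathsf{TO}^{r}_{\mathsf{Spin}}(H_S,T)}$.
   Context: $\operatorname{ad}_{H_S}=[H_S,\cdot\,]$, and $\sigma(\operatorname{ad}_{H_S})$ is the set of differences of eigenvalues of $H_S$. For $m\in\mathbb N$, $H_B\in\mathbb C^{m\times m}$ Hermitian, $U\in\mathbb C^{mn\times mn}$ unitary and $T\in(0,\infty)$ define $$\Phi_{T,m}(H_B,U)(X):=\operatorname{tr}_B\Big(U\Big(X\otimes\frac{e^{-H_B/T}}{\operatorname{tr}(e^{-H_B/T})}\Big)U^*\Big),\qquad X\in\mathbb C^{n\times n},$$ where $\operatorname{tr}_B$ is the partial trace over the second tensor factor of $\mathbb C^n\otimes\mathbb C^m$. For $T=\infty$ the Gibbs state is replaced by the maximally mixed state: $\Phi_{\infty,m}(H_B,U)(X):=\operatorname{tr}_B(U(X\otimes\frac{1}{m}\mathbb 1_m)U^* )$. The set of thermal operations $\mathsf{TO}(H_S,T)$ consists of all $\Phi_{T,m}(H_B,U)$ with $m\in\mathbb N$, $H_B\in\mathbb C^{m\times m}$ Hermitian, and $U$ unitary satisfying $U(H_S\otimes\mathbb 1_m+\mathbb 1_n\otimes H_B)U^*=H_S\otimes\mathbb 1_m+\mathbb 1_n\otimes H_B$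 (also imposed when $T=\infty$). For $r>0$, $\mathsf{TO}^{r}_{\mathsf{Spin}}(H_S,T)$ is the set of all maps $\Phi_{T,M}(H_B,e^{iH_{\mathrm{tot}}})$ where $m\in\mathbb N$, $\beta_1,\ldots,\beta_m\in\mathbb N=\{1,2,\ldots\}$, $M=\sum_{j=1}^m\beta_j$, $H_B=\bigoplus_{j=1}^m jr\,\mathbb 1_{\beta_j}$, and $H_{\mathrm{tot}}\in\mathbb C^{nM\times nM}$ is Hermitian with $[H_{\mathrm{tot}},H_S\otimes\mathbb 1_M+\mathbb 1_n\otimes H_B]=0$. A bar denotes closure in the finite-dimensional space of linear maps on $\mathbb C^{n\times n}$. *)

(* Defs.v *)
(* The complex numbers are R[i] for an arbitrary R : realType. *)
From HB Require Import structures.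
From mathcomp Require Import all_boot all_order all_algebra.
From mathcomp Require Import sesquilinear spectral.
From mathcomp Require Import all_classical all_reals all_analysis.
From mathcomp Require Import complex mxtens.

Set Implicit Arguments.
Unset Strict Implicit.
Unset Printing Implicit Defensive.

Import Order.TTheory GRing.Theory Num.Theory.
Import numFieldNormedType.Exports.

Local Open Scope classical_set_scope.
Local Open Scope ring_scope.
Local Open Scope complex_scope.
Local Open Scope sesquilinear_scope.

(* Stated over an abstract numFieldType because the library puts a topology on
   numFieldTypes, and hence on matrices over them, but not directly on R[i]. *)
Definition mexp (K : numFieldType) (n : nat) (A : 'M[K]_n) : 'M[K]_n :=
  limn (series (fun k => k`!%:R^-1 *: A ^+ k)).

(* Closure of a set of linear maps on K^(n x n).  lin_mx F is the matrix of F in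
   the basis of matrix units, so it identifies 'End('M_n) linearly with
   'M_(n * n); a finite-dimensional space has only one vector space topology
   that is Hausdorff, so this choice of coordinates is immaterial. *)
Definition lin_closure (K : numFieldType) (n : nat) (S : set 'End('M[K]_n)) :
    set 'End('M[K]_n) :=
  [set F : 'End('M[K]_n) |
    closure [set lin_mx (G : 'M[K]_n -> 'M[K]_n) | G in S]
            (lin_mx (F : 'M[K]_n -> 'M[K]_n))].

Section Bracket.
Variables (K : fieldType) (n : nat).

Definition mxbracket (A B : 'M[K]_n) : 'M[K]_n := A *m B - B *m A.

Lemma mxbracket_is_linear A : linear (mxbracket A).
Proof.
move=> a X Y; rewrite /mxbracket mulmxDr mulmxDl -scalemxAr -scalemxAl.
by rewrite scalerBr opprD addrACA.
Qed.

HB.instance Definition _ A :=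
  GRing.isLinear.Build K 'M[K]_n 'M[K]_n *:%R (mxbracket A)
    (mxbracket_is_linear A).

(* In finite dimension the spectrum of ad_H = [H, -] consists of its eigenvalues. *)
Definition ad_spectrum (H : 'M[K]_n) : set K :=
  [set c | passmx.leigenvalue (linfun (mxbracket H)) c].

End Bracket.

Section ThermalOperations.
Variable R : realType.

Notation "A *t B" := (tensmx A B) (at level 40, left associativity).

Definition ptrace2 (n m : nat) (A : 'M[R[i]]_(n * m)) : 'M[R[i]]_n :=
  \matrix_(i, j) \sum_(k < m) A (mxtens_index (i, k)) (mxtens_index (j, k)).

(* The bath state at temperature T.  Only 0 < T <= +oo is meaningful; the else
   branch is meant for T = +oo. *)
Definition gibbs (T : \bar R) (m : nat) (HB : 'M[R[i]]_m) : 'M[R[i]]_m :=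
  if T is t%:E then
    let E := @mexp R[i] m (- t%:C^-1 *: HB) in (\tr E)^-1 *: E
  else m%:R^-1 *: 1%:M.

Definition thermal_channel (T : \bar R) (n m : nat) (HB : 'M[R[i]]_m)
    (U : 'M[R[i]]_(n * m)) (X : 'M[R[i]]_n) : 'M[R[i]]_n :=
  ptrace2 (U *m (X *t gibbs T HB) *m U^t*).

Lemma thermal_channel_is_linear T n m (HB : 'M[R[i]]_m) (U : 'M[R[i]]_(n * m)) :
  linear (thermal_channel T HB U).
Proof.
move=> a X Y; rewrite /thermal_channel; set G := gibbs T HB.
have -> : (a *: X + Y) *t G = a *: (X *t G) + Y *t G.
  by apply/matrixP => i j; rewrite !mxE mulrDl mulrA.
rewrite mulmxDr mulmxDl -scalemxAr -scalemxAl.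
apply/matrixP => i j; rewrite !mxE mulr_sumr -big_split/=.
by apply: eq_bigr => k _; rewrite !mxE.
Qed.

HB.instance Definition _ T n m (HB : 'M[R[i]]_m) (U : 'M[R[i]]_(n * m)) :=
  GRing.isLinear.Build R[i] 'M[R[i]]_n 'M[R[i]]_n *:%R (thermal_channel T HB U)
    (thermal_channel_is_linear T HB U).

Definition total_energy (n m : nat) (HS : 'M[R[i]]_n) (HB : 'M[R[i]]_m) :
    'M[R[i]]_(n * m) :=
  HS *t 1%:M + 1%:M *t HB.

Definition TO (n : nat) (HS : 'M[R[i]]_n) (T : \bar R) :
    set 'End('M[R[i]]_n) :=
  [set F | exists (m : nat) (HB : 'M[R[i]]_m) (U : 'M[R[i]]_(n * m)),
    [/\ (0 < m)%N,
        HB \is hermsymmx,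
        U \is unitarymx,
        U *m total_energy HS HB *m U^t* = total_energy HS HB &
        F = linfun (thermal_channel T HB U)]].

(* The index j : 'I_m counts from 0, so the j-th block has energy j.+1 * r. *)
Definition spin_bath (r : R) (m : nat) (beta : 'I_m -> nat) :
    'M[R[i]]_(\sum_j beta j) :=
  \mxdiag_(j < m) ((j.+1%:R * r)%:C%:M : 'M[R[i]]_(beta j)).

Definition TOspin (r : R) (n : nat) (HS : 'M[R[i]]_n) (T : \bar R) :
    set 'End('M[R[i]]_n) :=
  [set F | exists (m : nat) (beta : 'I_m -> nat)
                  (Htot : 'M[R[i]]_(n * \sum_j beta j)),
    [/\ (0 < m)%N,
        forall j, (0 < beta j)%N,
        Htot \is hermsymmx,
        mxbracket Htot (total_energy HS (spin_bath r beta)) = 0 &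
        F = linfun (thermal_channel T (spin_bath r beta)
                      (@mexp R[i] _ ('i *: Htot)))]].

End ThermalOperations.

(* Main.v *)
Require Import Defs.
From mathcomp Require Import all_boot all_order all_algebra.
From mathcomp Require Import sesquilinear spectral.
From mathcomp Require Import all_classical all_reals all_analysis.
From mathcomp Require Import complex mxtens.
From mathcomp Require Import zify ring lra.

(* Writing U as an m x m matrix of n x n blocks U_kl in an eigenbasis of H_B
   with energies b_k, energy conservation reads [H_S, U_kl] = (b_l - b_k) U_kl.
   A nonzero block makes b_l - b_k a Bohr frequency, hence an integer multiple
   of r: U only couples bath levels in the same class modulo r Z.  Put
   b_k = s_k + r z_k with z_k integer and s_k in [0, r).  Replacing b_k by
   N_k ~ v e^{- s_k / T} copies of the level r z_k, up to a global shift, on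
   which U acts as U_kl times the identity, yields a spin bath with the
   same Gibbs weights in the limit v -> oo.  One extra state on each of the
   levels, where U acts trivially, makes all multiplicities positive at a cost
   that vanishes as v -> oo.  Finally the modified U is exp(i H_tot) with
   H_tot a function of U, so H_tot conserves energy as well. *)

Import Order.TTheory GRing.Theory Num.Theory.
Import numFieldNormedType.Exports.

Local Open Scope classical_set_scope.
Local Open Scope ring_scope.
Local Open Scope complex_scope.
Local Open Scope sesquilinear_scope.

Set Implicit Arguments.
Unset Strict Implicit.
Unset Printing Implicit Defensive.

(** * Matrix exponentials and logarithms *)

Section Convergence.
Variable K : numFieldType.

(* K is abstract because R[i] carries a topology only as a numFieldType. *)
Definition num_cvg (u : nat -> K) (l : K) := u @ \oo --> l.

Lemma num_cvgP u l :
  num_cvg u l <-> forall e, 0 < e -> \forall k \near \oo, `|l - u k| < e.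
Proof. exact: cvgrPdist_lt. Qed.

Lemma num_cvg_cst a : num_cvg (fun=> a) a.
Proof. exact: cvg_cst. Qed.

Lemma num_cvgD u v a b :
  num_cvg u a -> num_cvg v b -> num_cvg (fun k => u k + v k) (a + b).
Proof. exact: cvgD. Qed.

Lemma num_cvgM u v a b :
  num_cvg u a -> num_cvg v b -> num_cvg (fun k => u k * v k) (a * b).
Proof. exact: cvgM. Qed.

Lemma num_cvg_sum (I : Type) (r : seq I) (u : I -> nat -> K) (a : I -> K) :
  (forall i, num_cvg (u i) (a i)) ->
  num_cvg (fun k => \sum_(i <- r) u i k) (\sum_(i <- r) a i).
Proof.
move=> ua; elim: r => [|i r IH].
  by under eq_fun do rewrite big_nil; rewrite big_nil; exact: num_cvg_cst.
by under eq_fun do rewrite big_cons; rewrite big_cons; exact: num_cvgD.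
Qed.

Lemma cvg_mx m n (A : nat -> 'M[K]_(m, n)) (L : 'M[K]_(m, n)) :
  (forall i j, num_cvg (fun k => A k i j) (L i j)) -> A @ \oo --> L.
Proof.
move=> AL; apply/cvgrPdist_lt => e e0.
have : \forall k \near \oo, forall ij : 'I_m * 'I_n,
    `|L ij.1 ij.2 - A k ij.1 ij.2| < e.
  apply: filter_forall => ij.
  by have /num_cvgP := AL ij.1 ij.2; exact.
apply: filterS => k Hk.
have := @mx_norm_ball K m n; rewrite predeq3E => /(_ L e (A k)) /= <-.
by split=> // i j; exact: (Hk (i, j)).
Qed.

(** A relation rather than a function: over an abstract [K] the exponential series need not
    converge. *)
Definition exp_cvg (z w : K) :=
  num_cvg (series (fun k => k`!%:R^-1 * z ^+ k)) w.

(** Each power of [V *m diag_mx d *m W] is [V] times a diagonal of powers times [W], so every entry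
    of the partial sums is a fixed linear combination of scalar exponential series. *)
Lemma mexp_similar m (V W : 'M[K]_m) (d e : 'rV[K]_m) : W *m V = 1%:M ->
  (forall l, exp_cvg (d 0 l) (e 0 l)) ->
  mexp (V *m diag_mx d *m W) = V *m diag_mx e *m W.
Proof.
move=> WV cvd; apply: (cvg_lim (@norm_hausdorff _ _)).
have VW : V *m W = 1%:M by exact: mulmx1C.
have powE k : (V *m diag_mx d *m W) ^+ k = V *m diag_mx (\row_l d 0 l ^+ k) *m W.
  elim: k => [|k IH].
    rewrite expr0 (_ : diag_mx _ = 1%:M) ?mulmx1 ?VW //.
    by apply/matrixP => i j; rewrite !mxE expr0.
  rewrite exprS IH -[LHS]/(_ *m _) !mulmxA -(mulmxA (V *m _) W V) WV mulmx1.
  rewrite -(mulmxA V) mulmx_diag; congr (_ *m diag_mx _ *m _).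
  by apply/rowP => l; rewrite !mxE exprS.
have entE (f : 'rV[K]_m) i j :
    (V *m diag_mx f *m W) i j = \sum_l V i l * f 0 l * W l j.
  by rewrite mul_mx_diag mxE; apply: eq_bigr => l _; rewrite !mxE.
apply: cvg_mx => i j; rewrite entE.
rewrite (_ : (fun k => _) = fun k => \sum_l V i l *
    series (fun k => k`!%:R^-1 * d 0 l ^+ k) k * W l j).
  apply: num_cvg_sum => l; apply: num_cvgM; last exact: num_cvg_cst.
  by apply: num_cvgM; [exact: num_cvg_cst|exact: cvd].
apply/funext => k; rewrite /series /= summxE.
under [RHS]eq_bigr do rewrite mulr_sumr mulr_suml.
rewrite exchange_big /=; apply: eq_bigr => p _.
rewrite mxE powE entE mulr_sumr; apply: eq_bigr => l _.
by rewrite mxE !mulrA; congr (_ * _ * _); rewrite mulrC.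
Qed.

End Convergence.

Section ComplexExponential.
Variable R : realType.

Lemma num_cvg_real (u : nat -> R) (l : R) :
  u @ \oo --> l -> @num_cvg R[i] (fun k => (u k)%:C) l%:C.
Proof.
move=> /cvgrPdist_lt ul; apply/num_cvgP => e e0.
(* A positive element of [R[i]] is real, so the tolerance can be handed over to its real part. *)
have /andP[/eqP eI eR] : (complex.Im e == 0) && (0 < complex.Re e).
  by move: e0; rewrite ltcE.
move: (ul _ eR); apply: filterS => k.
rewrite -rmorphB normc_def /= expr0n /= addr0 sqrtr_sqr.
by rewrite ltcE /= eI eqxx.
Qed.

Lemma exp_cvg_expR (x : R) : @exp_cvg R[i] x%:C (expR x)%:C.
Proof.
rewrite /exp_cvg.
rewrite (_ : series _ = fun k => (series (exp_coeff x) k)%:C).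
  by apply: num_cvg_real; exact: is_cvg_series_exp_coeff.
apply/funext => k; rewrite /series /= rmorph_sum; apply: eq_bigr => p _.
by rewrite /exp_coeff /= rmorphM fmorphV rmorphXn rmorph_nat mulrC.
Qed.

Definition cis (x : R) : R[i] := cos x +i* sin x.

Lemma exp_cvg_cis (x : R) : @exp_cvg R[i] ('i * x%:C) (cis x).
Proof.
rewrite -complexiE /exp_cvg.
rewrite (_ : series _ = fun k => (series (cos_coeff x) k)%:C +
    'i * (series (sin_coeff x) k)%:C).
  rewrite /cis [X in num_cvg _ X]complexE; apply: num_cvgD.
    by apply: num_cvg_real; rewrite cos.unlock; exact: is_cvg_series_cos_coeff.
  apply: num_cvgM; first exact: num_cvg_cst.
  by apply: num_cvg_real; rewrite sin.unlock; exact: is_cvg_series_sin_coeff.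
apply/funext => k; rewrite /series /= !rmorph_sum mulr_sumr -big_split /=.
(* With [q] half of [p], the even terms carry [(-1) ^+ q] and give the cosine; the odd ones keep one
   extra factor ['i] and give the sine. *)
apply: eq_bigr => p _; rewrite /cos_coeff /sin_coeff !rmorphM !rmorphXn !fmorphV.
rewrite !rmorph_nat exprMn -(odd_double_half p); set q := p./2.
have i2 : ('i : R[i]) ^+ 2 = -1 by exact: sqr_i.
have iE : ('i : R[i]) ^+ q.*2 = (-1) ^+ q by rewrite -mul2n exprM i2.
case: (odd p); rewrite /= ?add0n ?odd_double ?add1n /= ?doubleK ?odd_double /=.
  rewrite rmorphN1 !mul0r add0r !mul1r exprS iE.
  by rewrite mulrC !mulrA.
by rewrite rmorphN1 !mul0r mulr0 addr0 mul1r iE mulrC.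
Qed.

Lemma cis_norm (x : R) : cis x * (cis x)^* = 1.
Proof. by rewrite /cis; simpc; rewrite -!expr2 cos2Dsin2 mulrC addNr. Qed.

Lemma cis_surj (z : R[i]) : z * z^* = 1 -> exists x, z = cis x.
Proof.
case: z => a b; simpc => -[]; rewrite -!expr2 => ab _.
have a1 : -1 <= a <= 1.
  rewrite -ler_norml -(expr_le1 (n := 2)) //.
  by rewrite real_normK ?num_real // -ab lerDl sqr_ge0.
have sE : sin (acos a) = `|b|.
  by rewrite sin_acos // -ab addrC addKr sqrtr_sqr.
have cE : cos (acos a) = a by rewrite acosK // in_itv.
(* [acos] only reaches the upper half circle; the lower half is reached by the opposite angle. *)
have [b0|b0] := leP 0 b.
  by exists (acos a); rewrite /cis cE sE ger0_norm.
by exists (- acos a); rewrite /cis cosN sinN cE sE ltr0_norm // opprK.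
Qed.

End ComplexExponential.

(** In the eigenbasis, commuting with [diag_mx d] forces the entry [B i j] to vanish unless
    [d 0 i = d 0 j], and then [e] takes equal values too. Thus whatever commutes with a
    diagonalisable operator commutes with every function of it. *)
Lemma commute_diag_fun (F : fieldType) m (V W A : 'M[F]_m) (d e : 'rV[F]_m) :
  W *m V = 1%:M -> (forall i j, d 0 i = d 0 j -> e 0 i = e 0 j) ->
  V *m diag_mx d *m W *m A = A *m (V *m diag_mx d *m W) ->
  V *m diag_mx e *m W *m A = A *m (V *m diag_mx e *m W).
Proof.
move=> WV de; have VW := mulmx1C WV.
have [B ->] : exists B, A = V *m B *m W.
  by exists (W *m A *m V); rewrite !mulmxA VW mul1mx -mulmxA VW mulmx1.
have conjE (X Y : 'M[F]_m) : V *m X *m W *m (V *m Y *m W) = V *m (X *m Y) *m W.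
  by rewrite !mulmxA -(mulmxA _ W) WV mulmx1.
rewrite !conjE => comVW.
have /matrixP comB : diag_mx d *m B = B *m diag_mx d.
  move/(congr1 (fun X => W *m X *m V)): comVW.
  by rewrite !mulmxA WV !mul1mx -!mulmxA WV !mulmx1.
congr (_ *m _ *m _); apply/matrixP => i j.
have := comB i j; rewrite !mul_diag_mx !mul_mx_diag !mxE.
have [->|B0 dE] := eqVneq (B i j) 0; first by rewrite !mulr0 !mul0r.
rewrite mulrC; congr (_ * _); apply: de; apply: (mulfI B0).
by rewrite -dE mulrC.
Qed.

Section Spectral.
Variable K : numClosedFieldType.

Lemma hermsymmxP m (H : 'M[K]_m) : reflect (H^t* = H) (H \is hermsymmx).
Proof.
by apply: (iffP (is_hermitianmxP _ _ _)); rewrite expr0 scale1r => /esym.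
Qed.

Lemma unitarymxPl m (U : 'M[K]_m) : U \is unitarymx -> U^t* *m U = 1%:M.
Proof. by move=> /unitarymxP /mulmx1C. Qed.

Lemma unitary_spectral m (U : 'M[K]_m) : U \is unitarymx ->
  exists (V : 'M[K]_m) (d : 'rV[K]_m), [/\ V \is unitarymx,
    V *m diag_mx d *m V^t* = U & forall l, d 0 l * Num.conj (d 0 l) = 1].
Proof.
move=> uU; have nU : U \is normalmx.
  by apply/normalmxP; rewrite (unitarymxP uU) unitarymxPl.
have /orthomx_spectralP := nU; set P := spectralmx U; set d := spectral_diag U.
have uP : P \is unitarymx by exact: spectral_unitarymx.
rewrite invmx_unitary // => UE.
have PP := unitarymxP uP.
have uD : diag_mx d \is unitarymx.
  have -> : diag_mx d = P *m U *m P^t*.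
    by rewrite UE !mulmxA PP mul1mx -mulmxA PP mulmx1.
  by rewrite !mul_unitarymx // trmxC_unitary.
exists (P^t*), d; split=> [||l]; rewrite ?trmxC_unitary ?trmxCK //.
have /matrixP/(_ l l) := unitarymxP uD.
by rewrite tr_diag_mx map_diag_mx mulmx_diag !mxE eqxx !mulr1n.
Qed.

Lemma herm_spectral m (H : 'M[K]_m) : H \is hermsymmx ->
  exists (V : 'M[K]_m) (d : 'rV[K]_m), [/\ V \is unitarymx,
    V *m diag_mx d *m V^t* = H & forall l, d 0 l \is Num.real].
Proof.
move=> hH; have /orthomx_spectralP := hermitian_normalmx hH.
have := hermitian_spectral_diag_real hH.
set P := spectralmx H; set d := spectral_diag H => /mxOverP dreal.
have uP : P \is unitarymx by exact: spectral_unitarymx.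
rewrite invmx_unitary // => HE.
by exists (P^t*), d; split=> //; rewrite ?trmxC_unitary ?trmxCK.
Qed.

Lemma conj_diag_unitary m (V : 'M[K]_m) (d : 'rV[K]_m) :
  V \is unitarymx -> (forall l, d 0 l * Num.conj (d 0 l) = 1) ->
  V *m diag_mx d *m V^t* \is unitarymx.
Proof.
move=> uV d1; rewrite !mul_unitarymx ?trmxC_unitary //.
apply/unitarymxP; rewrite tr_diag_mx map_diag_mx mulmx_diag.
by apply/matrixP => i j; rewrite !mxE d1.
Qed.

Lemma conj_diag_herm m (V : 'M[K]_m) (d : 'rV[K]_m) :
  (forall l, Num.conj (d 0 l) = d 0 l) -> V *m diag_mx d *m V^t* \is hermsymmx.
Proof.
move=> dR; apply/hermsymmxP; rewrite !trmx_mul !map_mxM /= trmxCK mulmxA.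
rewrite tr_diag_mx map_diag_mx; congr (_ *m diag_mx _ *m _).
by apply/rowP => l; rewrite mxE; exact: dR.
Qed.


(** Taking logarithms of the eigenvalues makes [H] a function of [U], which is how energy
    conservation passes from a unitary to its generator. *)
Lemma unitary_log m (U : 'M[K]_m) :
  (forall z : K, z * Num.conj z = 1 ->
     exists2 x, x \is Num.real & exp_cvg ('i%R * x) z) ->
  U \is unitarymx ->
  exists H : 'M[K]_m, [/\ H \is hermsymmx, mexp ('i%R *: H) = U &
    forall A, U *m A = A *m U -> H *m A = A *m H].
Proof.
move=> log /unitary_spectral[V [d [uV <- d1]]]; have VV := unitarymxPl uV.
(* One logarithm is chosen per scalar, not per index, so that equal eigenvalues of [U] give equal
   eigenvalues of [H]; the value 0 off the unit circle is arbitrary. *)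
have /choice[h hE] : forall z : K, exists x, z * Num.conj z = 1 ->
    x \is Num.real /\ exp_cvg ('i%R * x) z.
  move=> z; have [/log[x]|z1] := pselect (z * Num.conj z = 1); first by exists x.
  by exists 0.
exists (V *m diag_mx (\row_l h (d 0 l)) *m V^t*); split.
- by apply: conj_diag_herm => l; rewrite mxE; apply/CrealP; exact: (hE _ (d1 l)).1.
- rewrite scalemxAl scalemxAr -linearZ; apply: mexp_similar => // l.
  by rewrite !mxE; exact: (hE _ (d1 l)).2.
- by move=> A; apply: commute_diag_fun => // i j; rewrite !mxE => ->.
Qed.

(** The same functional calculus in the other direction, with one unimodular exponential chosen per
    real eigenvalue. *)
Lemma mexp_herm m (H : 'M[K]_m) :
  (forall x : K, x \is Num.real ->
     exists2 z, z * Num.conj z = 1 & exp_cvg ('i%R * x) z) ->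
  H \is hermsymmx ->
  mexp ('i%R *: H) \is unitarymx /\
  forall A, H *m A = A *m H -> mexp ('i%R *: H) *m A = A *m mexp ('i%R *: H).
Proof.
move=> exi /herm_spectral[V [d [uV <- dreal]]]; have VV := unitarymxPl uV.
have /choice[e eE] : forall z : K, exists w, z \is Num.real ->
    w * Num.conj w = 1 /\ exp_cvg ('i%R * z) w.
  move=> z; have [/exi[w]|z1] := pselect (z \is Num.real); first by exists w.
  by exists 0.
have -> : mexp ('i%R *: (V *m diag_mx d *m V^t*)) =
    V *m diag_mx (\row_l e (d 0 l)) *m V^t*.
  rewrite scalemxAl scalemxAr -linearZ; apply: mexp_similar => // l.
  by rewrite !mxE; exact: (eE _ (dreal l)).2.
split.
  by apply: conj_diag_unitary => // l; rewrite mxE; exact: (eE _ (dreal l)).1.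
by move=> A; apply: commute_diag_fun => // i j; rewrite !mxE => ->.
Qed.

End Spectral.

Section ComplexLog.
Variable R : realType.

Lemma complex_log (z : R[i]) : z * Num.conj z = 1 ->
  exists2 x : R[i], x \is Num.real & @exp_cvg R[i] ('i%R * x) z.
Proof.
move=> /cis_surj[x ->]; exists x%:C; first by apply/complex_realP; exists x.
exact: exp_cvg_cis.
Qed.

Lemma complex_cis (x : R[i]) : x \is Num.real ->
  exists2 z : R[i], z * Num.conj z = 1 & @exp_cvg R[i] ('i%R * x) z.
Proof.
move=> /complex_realP[y ->]; exists (cis y); first exact: cis_norm.
exact: exp_cvg_cis.
Qed.

End ComplexLog.

(** * Block form of operators on the composite system *)

Section Blocks.
Variables (K : numClosedFieldType) (n : nat).
Local Notation "A *t B" := (tensmx A B) (at level 40, left associativity).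

Definition blk m (A : 'M[K]_(n * m)) (k l : 'I_m) : 'M[K]_n :=
  \matrix_(i, j) A (mxtens_index (i, k)) (mxtens_index (j, l)).

Definition unblk m (F : 'I_m -> 'I_m -> 'M[K]_n) : 'M[K]_(n * m) :=
  \matrix_(s, t) F (mxtens_unindex s).2 (mxtens_unindex t).2
                   (mxtens_unindex s).1 (mxtens_unindex t).1.

Lemma blkP m (A B : 'M[K]_(n * m)) :
  (forall k l, blk A k l = blk B k l) -> A = B.
Proof.
move=> AB; apply/matrixP => s t.
case: (mxtens_indexP s) => i k; case: (mxtens_indexP t) => j l.
by have /matrixP/(_ i j) := AB k l; rewrite !mxE.
Qed.

Lemma unblkK m (F : 'I_m -> 'I_m -> 'M[K]_n) : blk (unblk F) = F.
Proof.
by apply/funext => k; apply/funext => l; apply/matrixP => i j;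
  rewrite !mxE !mxtens_indexK.
Qed.

Lemma blkD m (A B : 'M[K]_(n * m)) k l : blk (A + B) k l = blk A k l + blk B k l.
Proof. by apply/matrixP => i j; rewrite !mxE. Qed.

Lemma blkM m (A B : 'M[K]_(n * m)) k l :
  blk (A *m B) k l = \sum_p blk A k p *m blk B p l.
Proof.
apply/matrixP => i j; rewrite !mxE summxE.
under [RHS]eq_bigr do rewrite mxE.
rewrite exchange_big pair_bigA (reindex (@mxtens_index n m)) /=.
  by apply: eq_bigr => -[a b] _; rewrite !mxE.
by exists (@mxtens_unindex n m) => ? _; rewrite (mxtens_indexK, mxtens_unindexK).
Qed.

Lemma blk_adj m (A : 'M[K]_(n * m)) k l : blk (A^t*) k l = (blk A l k)^t*.
Proof. by apply/matrixP => i j; rewrite !mxE. Qed.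

Lemma blk_tens m (X : 'M[K]_n) (D : 'M[K]_m) k l : blk (X *t D) k l = D k l *: X.
Proof. by apply/matrixP => i j; rewrite !mxE !mxtens_indexK mulrC. Qed.

Lemma blk1 m k l : blk (1%:M : 'M[K]_(n * m)) k l = (k == l)%:R%:M.
Proof.
apply/matrixP => i j; rewrite !mxE (can_eq (@mxtens_indexK n m)) xpair_eqE.
by case: (i == j); case: (k == l); rewrite ?mulr1n ?mulr0n.
Qed.

(** Blocks are indexed by any finite type, not only by an ordinal, so that later baths can be sum
    types. *)
Definition block_unitary (Y : finType) (U : Y -> Y -> 'M[K]_n) :=
  forall k l, \sum_p U k p *m (U l p)^t* = (k == l)%:R%:M.

Definition block_conserving (Y : finType) (HS : 'M[K]_n) (b : Y -> K)
    (U : Y -> Y -> 'M[K]_n) :=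
  forall k l, mxbracket HS (U k l) = (b l - b k) *: U k l.

(** The Kraus form of the channel when the bath state is diagonal with weights [p]: the bath starts
    in [l], ends in [k], and the partial trace sums over the end. *)
Definition block_channel (Y : finType) (p : Y -> K) (U : Y -> Y -> 'M[K]_n)
    (X : 'M[K]_n) : 'M[K]_n :=
  \sum_k \sum_l p l *: (U k l *m X *m (U k l)^t*).

Lemma unitary_blkP m (A : 'M[K]_(n * m)) :
  A \is unitarymx <-> block_unitary (blk A).
Proof.
have E k l : blk (A *m A^t*) k l = \sum_p blk A k p *m (blk A l p)^t*.
  by rewrite blkM; apply: eq_bigr => p _; rewrite blk_adj.
split=> [/unitarymxP AA k l|uA]; first by rewrite -E AA blk1.
by apply/unitarymxP/blkP => k l; rewrite E uA blk1.
Qed.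

Lemma blk_tens1 m (X : 'M[K]_n) k l :
  blk (X *t (1%:M : 'M[K]_m)) k l = (k == l)%:R *: X.
Proof. by rewrite blk_tens mxE. Qed.

Lemma sum_diag (Y : finType) (V : lmodType K) (k : Y) (f : Y -> K) (F : Y -> V) :
  \sum_p (f p *+ (k == p)) *: F p = f k *: F k.
Proof.
rewrite (bigD1 k) //= eqxx mulr1n big1 ?addr0 // => p.
by rewrite eq_sym => /negPf ->; rewrite mulr0n scale0r.
Qed.

(** The bath term multiplies block [(k, l)] by [b 0 l] on one side and by [b 0 k] on the other, so
    commutation becomes, block by block, a commutator equation with [HS] alone. *)
Lemma commute_blkP m (A : 'M[K]_(n * m)) (HS : 'M[K]_n) (b : 'rV[K]_m) :
  A *m (HS *t 1%:M + 1%:M *t diag_mx b) = (HS *t 1%:M + 1%:M *t diag_mx b) *m A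
  <-> block_conserving HS (b 0) (blk A).
Proof.
have El k l : blk (A *m (HS *t 1%:M + 1%:M *t diag_mx b)) k l =
    blk A k l *m HS + b 0 l *: blk A k l.
  rewrite blkM; under eq_bigr => p _.
    rewrite blkD !blk_tens !mxE !(eq_sym p) mulmxDr -!scalemxAr mulmx1.
    over.
  rewrite big_split /=; congr (_ + _).
    by rewrite (sum_diag l (fun=> 1) (fun p => blk A k p *m HS)) scale1r.
  by rewrite (sum_diag l (b 0) (blk A k)).
have Er k l : blk ((HS *t 1%:M + 1%:M *t diag_mx b) *m A) k l =
    HS *m blk A k l + b 0 k *: blk A k l.
  rewrite blkM; under eq_bigr => p _.
    rewrite blkD !blk_tens !mxE mulmxDl -!scalemxAl mul1mx.
    over.
  rewrite big_split /=; congr (_ + _).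
    by rewrite (sum_diag k (fun=> 1) (fun p => HS *m blk A p l)) scale1r.
  by rewrite (sum_diag k (fun=> b 0 k) (fun p => blk A p l)).
have E (X Y : 'M[K]_n) (c d : K) (Z : 'M[K]_n) :
    (X + c *: Z = Y + d *: Z) <-> (Y - X = (c - d) *: Z).
  rewrite scalerBl; split=> XY.
    have -> : Y = X + c *: Z - d *: Z by rewrite XY addrK.
    by rewrite addrAC [X + _]addrC addrK.
  have -> : Y = X + (c *: Z - d *: Z) by rewrite -XY addrC subrK.
  by rewrite -addrA subrK.
split=> [AC k l|AC].
  by rewrite /mxbracket; apply/E; rewrite -El -Er AC.
by apply/blkP => k l; rewrite El Er; apply/E; exact: AC.
Qed.

Lemma block_channelE m (A : 'M[K]_(n * m)) (p : 'rV[K]_m) X :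
  \sum_k blk (A *m (X *t diag_mx p) *m A^t*) k k =
  block_channel (p 0) (blk A) X.
Proof.
apply: eq_bigr => k _; rewrite blkM; apply: eq_bigr => l _.
rewrite blk_adj blkM [RHS]scalemxAl; congr (_ *m _).
under eq_bigr => q _.
  rewrite blk_tens !mxE -scalemxAr (eq_sym q).
  over.
by rewrite (sum_diag l (p 0) (fun q => blk A k q *m X)).
Qed.

(** The partial trace is cyclic with respect to operators acting on the bath only, so the choice of
    bath basis does not affect the channel. *)
Lemma sum_blk_conj m (V W : 'M[K]_m) (A : 'M[K]_(n * m)) : W *m V = 1%:M ->
  \sum_k blk ((1%:M *t V) *m A *m (1%:M *t W)) k k = \sum_k blk A k k.
Proof.
move=> WV.
have E k : blk ((1%:M *t V) *m A *m (1%:M *t W)) k k =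
    \sum_q \sum_p (W q k * V k p) *: blk A p q.
  rewrite blkM; apply: eq_bigr => q _; rewrite blkM blk_tens -scalemxAr mulmx1.
  rewrite scaler_sumr; apply: eq_bigr => p _.
  by rewrite blk_tens -scalemxAl mul1mx scalerA.
under eq_bigr do rewrite E.
rewrite exchange_big; apply: eq_bigr => q _ /=; rewrite exchange_big /=.
under eq_bigr => p _.
  rewrite -scaler_suml (_ : \sum_i _ = 1 *+ (q == p)); last first.
    by have /matrixP/(_ q p) := WV; rewrite !mxE.
  over.
by rewrite (sum_diag q (fun=> 1) (fun p => blk A p q)) scale1r.
Qed.

End Blocks.

(** * Thermal operations in block form *)

Section AbstractThermal.
Variable K : numClosedFieldType.
Local Notation "A *t B" := (tensmx A B) (at level 40, left associativity).

Lemma gibbs_similar m (a : K) (V W : 'M[K]_m) (d e : 'rV[K]_m) : W *m V = 1%:M ->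
  (forall l, exp_cvg (a * d 0 l) (e 0 l)) ->
  (\tr (mexp (a *: (V *m diag_mx d *m W))))^-1 *: mexp (a *: (V *m diag_mx d *m W)) =
  V *m diag_mx (\row_l (e 0 l / \sum_k e 0 k)) *m W.
Proof.
move=> WV ae; rewrite scalemxAl scalemxAr -linearZ.
rewrite (@mexp_similar _ _ _ _ (a *: d) e) //; last by move=> l; rewrite mxE.
rewrite mxtrace_mulC mulmxA WV mul1mx mxtrace_diag scalemxAl scalemxAr -linearZ.
by congr (_ *m diag_mx _ *m _); apply/rowP => l; rewrite !mxE mulrC.
Qed.

Lemma tensmx11 n m : (1%:M : 'M[K]_n) *t (1%:M : 'M[K]_m) = 1%:M.
Proof. by apply/blkP => k l; rewrite blk_tens1 blk1 scalemx1. Qed.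

Lemma tens1_adj n m (V : 'M[K]_m) :
  ((1%:M : 'M[K]_n) *t V)^t* = (1%:M : 'M[K]_n) *t V^t*.
Proof. by rewrite trmx_tens map_mxT trmx1 map_mx1. Qed.

Lemma tens1_unitary n m (V : 'M[K]_m) :
  V \is unitarymx -> (1%:M : 'M[K]_n) *t V \is unitarymx.
Proof.
move=> uV; apply/unitarymxP.
by rewrite tens1_adj tensmx_mul mul1mx (unitarymxP uV) tensmx11.
Qed.

(** [F] consists of the blocks of [U] conjugated by [1%:M *t V], which diagonalises the bath;
    unitarity, conservation and the traced channel survive this change of basis. *)
Lemma rotate_bath n m (HS : 'M[K]_n) (U : 'M[K]_(n * m)) (V : 'M[K]_m)
    (d p : 'rV[K]_m) (D := V *m diag_mx d *m V^t*) :
  V \is unitarymx -> U \is unitarymx ->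
  U *m (HS *t 1%:M + 1%:M *t D) *m U^t* = HS *t 1%:M + 1%:M *t D ->
  exists F : 'I_m -> 'I_m -> 'M[K]_n, [/\ block_unitary F,
    block_conserving HS (d 0) F &
    forall X, \sum_k blk (U *m (X *t (V *m diag_mx p *m V^t*)) *m U^t*) k k =
      block_channel (p 0) F X].
Proof.
move=> uV uU UH; set V1 := (1%:M : 'M[K]_n) *t V.
set W1 := (1%:M : 'M[K]_n) *t V^t*.
have uV1 : V1 \is unitarymx by exact: tens1_unitary.
have WE : W1 = V1^t* by rewrite /V1 tens1_adj.
have VW : V1 *m W1 = 1%:M by rewrite WE; exact: unitarymxP.
have WV : W1 *m V1 = 1%:M by exact: mulmx1C.
have tensE X (q : 'rV[K]_m) : X *t (V *m diag_mx q *m V^t*) =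
    V1 *m (X *t diag_mx q) *m W1.
  by rewrite /V1 /W1 !tensmx_mul mul1mx mulmx1.
have tens1E (X : 'M[K]_n) : X *t (1%:M : 'M[K]_m) = V1 *m (X *t 1%:M) *m W1.
  by rewrite /V1 /W1 !tensmx_mul mul1mx !mulmx1 (unitarymxP uV).
pose Y := W1 *m U *m V1.
have UE : U = V1 *m Y *m W1 by rewrite /Y !mulmxA VW mul1mx -mulmxA VW mulmx1.
have UaE : U^t* = V1 *m Y^t* *m W1.
  by rewrite UE !trmx_mul !map_mxM /= WE trmxCK mulmxA.
have uY : Y \is unitarymx.
  rewrite /Y; apply: mul_unitarymx => //; apply: mul_unitarymx => //.
  by rewrite WE trmxC_unitary.
have conjE (A B : 'M[K]_(n * m)) : V1 *m A *m W1 *m (V1 *m B *m W1) =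
    V1 *m (A *m B) *m W1.
  by rewrite !mulmxA -(mulmxA _ W1) WV mulmx1.
exists (blk Y); split.
- by move/unitary_blkP: uY.
- apply/commute_blkP; set H := _ + _.
  have HE : HS *t 1%:M + 1%:M *t D = V1 *m H *m W1.
    by rewrite tensE tens1E /H mulmxDr mulmxDl.
  (* Multiplying by [U] on the right turns invariance under conjugation into commutation, which is
     then carried to the rotated basis. *)
  move: UH; rewrite HE => /(congr1 (fun A => W1 *m (A *m U) *m V1)).
  rewrite -!mulmxA (mulmxA (U^t*)) (unitarymxPl uU) mul1mx UE.
  by rewrite !mulmxA WV !mul1mx -!mulmxA WV !mulmx1 !(mulmxA W1) WV !mul1mx.
- move=> X; rewrite -block_channelE tensE UaE UE !conjE.
  by apply: sum_blk_conj; exact: unitarymxPl.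
Qed.

End AbstractThermal.

Section Bath.
Variable R : realType.
Local Notation C := R[i].

(* 1 / T, hence 0 for T = +oo, which unifies the two cases of gibbs. *)
Definition inv_temp (T : \bar R) : R := if T is t%:E then t^-1 else 0.

Definition gibbs_weight (tau : R) (Y : finType) (b : Y -> R) (l : Y) : R :=
  expR (- tau * b l) / \sum_k expR (- tau * b k).

Lemma gibbs_diag (T : \bar R) m (V W : 'M[C]_m) (x : 'I_m -> R) :
  W *m V = 1%:M ->
  gibbs T (V *m diag_mx (\row_l (x l)%:C) *m W) =
  V *m diag_mx (\row_l (gibbs_weight (inv_temp T) x l)%:C) *m W.
Proof.
move=> WV; have [[t ->]|Tinf] : (exists t, T = t%:E) \/ inv_temp T = 0 /\
    forall m (HB : 'M[C]_m), gibbs T HB = m%:R^-1 *: 1%:M.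
- by case: T => [t||]; [left; exists t|right|right].
- pose e : 'rV[C]_m := \row_l (expR (- t^-1 * x l))%:C.
  have ae l : @exp_cvg C (- t%:C^-1 * (\row_l (x l)%:C) 0 l) (e 0 l).
    by rewrite !mxE -fmorphV -rmorphN -rmorphM; exact: exp_cvg_expR.
  have -> : \row_l (gibbs_weight (inv_temp t%:E) x l)%:C =
      \row_l (e 0 l / \sum_k e 0 k) :> 'rV[C]_m; last exact: gibbs_similar WV ae.
  apply/rowP => l; rewrite !mxE rmorphM fmorphV rmorph_sum; congr (_ / _).
  by apply: eq_bigr => k _; rewrite mxE.
(* At inverse temperature 0 all Boltzmann factors are 1, so the weights are uniform and the basis
   change cancels. *)
- rewrite Tinf.2 Tinf.1.
  rewrite (_ : \row_l _ = const_mx m%:R^-1).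
    rewrite diag_const_mx mul_mx_scalar -scalemxAl.
    by rewrite (mulmx1C WV).
  apply/rowP => l; rewrite !mxE /gibbs_weight.
  under eq_bigr do rewrite oppr0 mul0r expR0.
  by rewrite oppr0 mul0r expR0 sumr_const card_ord mul1r fmorphV rmorph_nat.
Qed.

(** A thermal channel reduced to a finite set of bath eigenstates, their energies and the blocks of
    the unitary. Baths in this form can be relabelled and enlarged freely. *)
Definition block_thermal n (HS : 'M[C]_n) (tau : R) (Y : finType) (b : Y -> R)
    (F : 'M[C]_n -> 'M[C]_n) :=
  exists U : Y -> Y -> 'M[C]_n, [/\ block_unitary U,
    block_conserving HS (fun l => (b l)%:C) U &
    forall X, F X = block_channel (fun l => (gibbs_weight tau b l)%:C) U X].

Lemma ptrace2E n m (A : 'M[C]_(n * m)) : ptrace2 A = \sum_k blk A k k.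
Proof.
apply/matrixP => i j; rewrite mxE summxE.
by apply: eq_bigr => k _; rewrite mxE.
Qed.

Lemma eq_conserving n (HS : 'M[C]_n) (Y : finType) (b b' : Y -> C) U :
  b =1 b' -> block_conserving HS b U -> block_conserving HS b' U.
Proof. by move=> bb' cU k l; rewrite -!bb'. Qed.

Lemma eq_block_channel n (Y : finType) (p p' : Y -> C) U (X : 'M[C]_n) :
  p =1 p' -> block_channel p U X = block_channel p' U X.
Proof.
by move=> pp'; do 2!apply: eq_bigr => ? _; rewrite pp'.
Qed.

Lemma TO_block n (HS : 'M[C]_n) (T : \bar R) (F : 'End('M[C]_n)) : TO HS T F ->
  exists m (b : 'I_m -> R), (0 < m)%N /\ block_thermal HS (inv_temp T) b F.
Proof.
move=> [m [HB [U [m0 hHB uU UH FE]]]].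
have [V [d [uV HBE dreal]]] := herm_spectral hHB.
pose b l := complex.Re (d 0 l).
have dE : d = \row_l (b l)%:C by apply/rowP => l; rewrite mxE /b RRe_real.
rewrite -HBE in UH.
pose p : 'rV[C]_m := \row_l (gibbs_weight (inv_temp T) b l)%:C.
have [W [uW cW WE]] := rotate_bath p uV uU UH.
exists m, b; split=> //; exists W; split=> //.
  by apply: eq_conserving cW => l; rewrite dE mxE.
move=> X; rewrite FE lfunE /= /thermal_channel ptrace2E.
have -> : gibbs T HB = V *m diag_mx p *m V^t*.
  by rewrite -HBE dE; exact: gibbs_diag (unitarymxPl uV).
by rewrite WE; apply: eq_block_channel => l; rewrite mxE.
Qed.

Lemma spin_bathE (r : R) M (beta : 'I_M -> nat) : spin_bath r beta =
  diag_mx (\row_s ((tagnat.sig1 s).+1%:R * r)%:C).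
Proof.
rewrite /spin_bath; under eq_mxdiag do rewrite -diag_const_mx.
rewrite -diag_mxrow; congr diag_mx; apply/rowP => s.
by rewrite !mxE.
Qed.

Lemma spin_total_diag (r : R) M (beta : 'I_M -> nat) n (HS : 'M[C]_n) :
  total_energy HS (spin_bath r beta) =
  tensmx HS 1%:M + tensmx 1%:M (diag_mx (\row_s ((tagnat.sig1 s).+1%:R * r)%:C)).
Proof. by rewrite /total_energy spin_bathE. Qed.

Lemma sum_gt0 M (beta : 'I_M -> nat) : (0 < M)%N ->
  (forall j, (0 < beta j)%N) -> (0 < \sum_j beta j)%N.
Proof.
case: M beta => // M beta _ beta0.
by rewrite big_ord_recl addn_gt0 beta0.
Qed.

(** The exponential of ['i] times a Hermitian generator is unitary and inherits its conservation
    law, so a spin operation is a thermal one. *)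
Lemma TOspin_sub_TO n (HS : 'M[C]_n) (T : \bar R) (r : R) :
  TOspin r HS T `<=` TO HS T.
Proof.
move=> F [M [beta [H [M0 beta0 hH HtotH ->]]]].
have [uU cU] := mexp_herm (@complex_cis R) hH.
exists (\sum_j beta j)%N, (spin_bath r beta), (@mexp C _ ('i *: H)); split=> //.
- exact: sum_gt0.
- apply/hermsymmxP; rewrite spin_bathE tr_diag_mx map_diag_mx; congr diag_mx.
  by apply/rowP => s; rewrite !mxE; exact: conjc_real.
- rewrite cU; last by apply/eqP; rewrite -subr_eq0; exact/eqP.
  by rewrite -mulmxA (unitarymxP uU) mulmx1.
Qed.

(** Here the logarithm enters: the blocks are reassembled into a unitary on the spin bath, and its
    generator, being a function of it, conserves the energy. *)
Lemma block_spin n (HS : 'M[C]_n) (T : \bar R) (r : R) M (beta : 'I_M -> nat)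
    (F : 'M[C]_n -> 'M[C]_n) : (0 < M)%N -> (forall j, (0 < beta j)%N) ->
  block_thermal HS (inv_temp T)
    (fun s : 'I_(\sum_j beta j) => (tagnat.sig1 s).+1%:R * r) F ->
  exists2 G : 'End('M[C]_n), TOspin r HS T G & forall X, G X = F X.
Proof.
move=> M0 beta0 [W [uW cW FE]].
pose U := unblk W.
have uU : U \is unitarymx.
  by apply/unitary_blkP; rewrite unblkK.
have UH : U *m total_energy HS (spin_bath r beta) =
    total_energy HS (spin_bath r beta) *m U.
  rewrite spin_total_diag; apply/commute_blkP; rewrite unblkK.
  by apply: eq_conserving cW => s; rewrite mxE.
have [H [hH HU cH]] := unitary_log (@complex_log R) uU.
exists (linfun (thermal_channel T (spin_bath r beta) (@mexp C _ ('i *: H)))).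
  by exists M, beta, H; split=> //; rewrite /mxbracket cH ?subrr.
move=> X; rewrite lfunE /= /thermal_channel ptrace2E FE.
pose p : 'rV[C]_(\sum_j beta j) := \row_s (gibbs_weight (inv_temp T)
  (fun s => (tagnat.sig1 s).+1%:R * r) s)%:C.
have -> : gibbs T (spin_bath r beta) = diag_mx p.
  rewrite spin_bathE; have := @gibbs_diag T _ 1%:M 1%:M
    (fun s : 'I_(\sum_j beta j) => (tagnat.sig1 s).+1%:R * r) (mul1mx _).
  by rewrite !mul1mx !mulmx1.
have -> : @mexp C _ ('i *: H) = U by exact: HU.
rewrite block_channelE unblkK; apply: eq_block_channel => s.
by rewrite mxE.
Qed.

End Bath.

(** * Closures of sets of linear maps *)

Section Closure.
Variables (K : numFieldType) (n : nat).

Lemma lin_closure_cvg (S : set 'End('M[K]_n)) (F : 'End('M[K]_n))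
    (G : nat -> 'End('M[K]_n)) :
  (forall k, S (G k)) ->
  (forall X i j, num_cvg (fun k => G k X i j) (F X i j)) -> lin_closure S F.
Proof.
move=> SG GF; rewrite /lin_closure /=.
pose u k := lin_mx (G k : 'M[K]_n -> 'M[K]_n).
have cu : \forall k \near \oo,
    closure [set lin_mx (H : 'M[K]_n -> 'M[K]_n) | H in S] (u k).
  by apply: nearW => k; apply: subset_closure; exists (G k).
apply: (closed_cvg _ (@closed_closure _ _) cu).
apply: cvg_mx => s t.
(* Row [s] of [lin_mx H] is the image under [H] of a matrix unit, so entrywise convergence of all
   images suffices. *)
have E (H : 'End('M[K]_n)) : lin_mx (H : 'M[K]_n -> 'M[K]_n) s t =
    mxvec (H (vec_mx (delta_mx 0 s))) 0 t.
  by rewrite -mul_rV_lin -rowE [RHS]mxE.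
rewrite /u E; under eq_fun do rewrite E.
case: (mxvec_indexP t) => i j; rewrite mxvecE; under eq_fun do rewrite mxvecE.
exact: GF.
Qed.

Lemma lin_closure_eq (S S' : set 'End('M[K]_n)) :
  S' `<=` S -> S `<=` lin_closure S' -> lin_closure S = lin_closure S'.
Proof.
move=> S'S SS'; apply/seteqP; split=> F; rewrite /lin_closure /=; last first.
  by apply: closure_subset => _ [G SG <-]; exists G => //; exact: S'S.
rewrite [X in _ -> X _](iffLR (closure_id _) (@closed_closure _ _)).
by apply: closure_subset => _ [G SG <-]; exact: SS'.
Qed.

End Closure.

(** * Relabelling bath states and sorting them by level *)

Section Reindex.
Variable R : realType.
Local Notation C := R[i].

Lemma block_thermal_bij n (HS : 'M[C]_n) (tau : R) (Y Y' : finType) (b : Y -> R)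
    (phi : Y' -> Y) F : bijective phi ->
  block_thermal HS tau b F -> block_thermal HS tau (b \o phi) F.
Proof.
move=> bphi [U [uU cU FE]]; have onphi P : {on P, bijective phi}.
  exact: onW_bij.
exists (fun k l => U (phi k) (phi l)); split.
- move=> k l; have := uU (phi k) (phi l); rewrite (bij_eq bphi) => <-.
  by rewrite [RHS](reindex phi).
- by move=> k l; exact: cU.
- move=> X; rewrite FE /block_channel (reindex phi) //.
  apply: eq_bigr => k _; rewrite (reindex phi) //; apply: eq_bigr => l _.
  by rewrite /gibbs_weight [in LHS](reindex phi).
Qed.

Section Spin.
Variables (Y : finType) (M : nat) (lev : Y -> 'I_M).
Let beta j := #|[pred y | lev y == j]|.

Definition level_elt (u : {j : 'I_M & 'I_(beta j)}) : Y :=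
  @enum_val _ [pred y | lev y == tag u] (tagged u).

Lemma lev_level_elt u : lev (level_elt u) = tag u.
Proof. by apply/eqP; exact: (enum_valP (tagged u)). Qed.

(** Injective because states of equal image share their level and [enum_val] is injective there;
    bijective by counting, since the fibres of [lev] partition [Y]. *)
Lemma level_elt_bij : bijective (level_elt \o @tagnat.sig M beta).
Proof.
apply: inj_card_bij.
  apply: inj_comp; last exact: tagnat.sig_inj.
  move=> u v uv; have := lev_level_elt u; rewrite uv lev_level_elt.
  case: u v uv => j a [j' a'] /= + jj'; case: _ / jj' in a a' *.
  by move=> /enum_val_inj aa'; congr (existT _ _ _); exact: aa'.
rewrite card_ord -sum1_card (partition_big lev xpredT) //=.
by apply: leq_sum => j _; rewrite /beta -sum1_card.
Qed.

End Spin.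

(** Sorting the states by level produces the block multiplicities, and surjectivity of [lev] makes
    each of them positive. *)
Lemma block_spin_levels n (HS : 'M[C]_n) (T : \bar R) (r : R) (Y : finType) M
    (lev : Y -> 'I_M) (F : 'M[C]_n -> 'M[C]_n) : (0 < M)%N ->
  (forall j, exists y, lev y = j) ->
  block_thermal HS (inv_temp T) (fun y => (lev y).+1%:R * r) F ->
  exists2 G : 'End('M[C]_n), TOspin r HS T G & forall X, G X = F X.
Proof.
move=> M0 levS /(block_thermal_bij (level_elt_bij lev)) bF.
apply: (@block_spin _ _ _ _ _ _ (fun j => #|[pred y | lev y == j]|)) => //.
  by move=> j; have [y yj] := levS j; apply/card_gt0P; exists y; rewrite inE yj.
rewrite (_ : (fun s => _) = ((fun y => (lev y).+1%:R * r) \o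
  (level_elt (lev := lev) \o @tagnat.sig M _))) //.
by apply/funext => s /=; rewrite lev_level_elt.
Qed.

End Reindex.

(** * Approximation by spin baths *)

Section Padding.
Variables (K : numClosedFieldType) (n m M : nat).
Variables (U : 'I_m -> 'I_m -> 'M[K]_n) (N : 'I_m -> nat) (lev : 'I_m -> 'I_M).
Hypothesis NU : forall k l, U k l != 0 -> N k = N l.

(* inl j is the filler state of level j, inr (k, a) the a-th copy of state k. *)
Local Notation bath := ('I_M + {k : 'I_m & 'I_(N k)})%type.

Definition pad_level (y : bath) : 'I_M :=
  match y with inl j => j | inr u => lev (tag u) end.

(** The identity on the fillers next to [U] acting from copy [a] to copy [a]. Copy numbers are
    compared as naturals because they live in different ordinals; [NU] ensures that no copy lacks
    its partner on a coupled state. *)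
Definition pad (y y' : bath) : 'M[K]_n :=
  match y, y' with
  | inl i, inl j => (i == j)%:R%:M
  | inr u, inr v => (tagged u == tagged v :> nat)%:R *: U (tag u) (tag v)
  | _, _ => 0
  end.

Lemma sum_bath (V : nmodType) (F : bath -> V) :
  \sum_y F y = \sum_j F (inl j) +
    \sum_k \sum_(a < N k) F (inr (Tagged (fun k => 'I_(N k)) a)).
Proof.
rewrite big_sumType /=; congr (_ + _); rewrite sig_big_dep /=.
by apply: eq_bigr => -[].
Qed.

Lemma sum_copies (V : lmodType K) (q a a' : nat) (Z : V) : (a < q)%N ->
  \sum_(c < q) ((a == c :> nat)%:R * (a' == c :> nat)%:R) *: Z = (a == a')%:R *: Z.
Proof.
move=> aq; rewrite (bigD1 (Ordinal aq)) //= eqxx mul1r big1 ?addr0.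
  by rewrite eq_sym.
by move=> c; rewrite -val_eqE /= eq_sym => /negPf ->; rewrite mul0r scale0r.
Qed.

Lemma adjZ (c : bool) (A : 'M[K]_n) : (c%:R *: A)^t* = c%:R *: A^t*.
Proof.
by apply/matrixP => i j; rewrite !mxE rmorphM /=; case: c; rewrite ?conjC1 ?conjC0.
Qed.

Lemma adj_nat (c : bool) : ((c%:R%:M : 'M[K]_n))^t* = c%:R%:M.
Proof. by rewrite -scalemx1 adjZ trmx1 map_mx1. Qed.

Lemma adj0 : (0 : 'M[K]_n)^t* = 0.
Proof. by rewrite trmx0 map_mx0. Qed.

Lemma pad_unitary : block_unitary U -> block_unitary pad.
Proof.
move=> uU [i|[k a]] [j|[l a']]; rewrite sum_bath /=.
- rewrite [X in _ + X]big1 ?addr0 => [|p _]; last by rewrite big1 // => c _; rewrite mul0mx.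
  rewrite (bigD1 i) //= eqxx mul1mx big1 ?addr0 => [|p pi].
    by rewrite adj_nat eq_sym.
  by rewrite eq_sym (negPf pi) -scalemx1 scale0r mul0mx.
- rewrite !big1 ?addr0 // => [|p _|p _].
  + by rewrite -scalemx1 scale0r.
  + by rewrite big1 // => c _; rewrite mul0mx.
  + by rewrite adj0 mulmx0.
- rewrite !big1 ?addr0 // => [|p _|p _].
  + by rewrite -scalemx1 scale0r.
  + by rewrite big1 // => c _; rewrite adj0 mulmx0.
  + by rewrite mul0mx.
- rewrite big1 ?add0r => [|p _]; last by rewrite mul0mx.
  under eq_bigr => p _.
    under eq_bigr => c _ do rewrite adjZ -scalemxAl -scalemxAr scalerA.
    have -> : \sum_(c < N p) ((a == c :> nat)%:R * (a' == c :> nat)%:R) *: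
        (U k p *m (U l p)^t*) = (a == a' :> nat)%:R *: (U k p *m (U l p)^t*).
      (* If [U k p] is nonzero then [N k = N p], so copy [a] exists on [p] as well and the sum meets
         it. *)
      have [->|Ukp] := eqVneq (U k p) 0.
        by rewrite mul0mx scaler0 big1 // => c _; rewrite scaler0.
      by apply: sum_copies; rewrite -(NU Ukp).
    over.
  rewrite -scaler_sumr uU scale_scalar_mx -natrM mulnb.
  congr (_%:R%:M); rewrite -[inr _ == inr _]/(existT _ k a == existT _ l a').
  have [kl|kl] := eqVneq k l; last first.
    by rewrite andbF -tag_eqE /tag_eq /= (negPf kl).
  by case: _ / kl a' => a'; rewrite andbT eq_Tagged /= -val_eqE.
Qed.

Lemma pad_conserving HS (b : 'I_M -> K) :
  block_conserving HS (b \o lev) U -> block_conserving HS (b \o pad_level) pad.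
Proof.
move=> cU [i|u] [j|v] /=; rewrite /mxbracket ?mulmx0 ?mul0mx ?subrr ?scaler0 //.
  rewrite scalar_mxC subrr; case: eqVneq => [->|_]; first by rewrite subrr scale0r.
  by rewrite -scalemx1 scale0r scaler0.
rewrite -scalemxAr -scalemxAl -scalerBr; have := cU (tag u) (tag v).
by rewrite /mxbracket => ->; rewrite !scalerA mulrC.
Qed.

Lemma pad_sum (V : nmodType) (w : 'I_M -> V) :
  \sum_y w (pad_level y) = \sum_j w j + \sum_l w (lev l) *+ N l.
Proof.
rewrite sum_bath; congr (_ + _); apply: eq_bigr => k _.
by rewrite /= sumr_const card_ord.
Qed.

(** The fillers leave [X] alone and contribute a multiple of it; the [N l] copies of each input
    state add up, so multiplicity acts as a weight. *)
Lemma pad_channel (w : 'I_M -> K) X :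
  block_channel (w \o pad_level) pad X =
  (\sum_j w j) *: X + block_channel (fun l => w (lev l) *+ N l) U X.
Proof.
rewrite /block_channel sum_bath /=; congr (_ + _).
  rewrite scaler_suml; apply: eq_bigr => i _; rewrite sum_bath /=.
  rewrite [X in _ + X]big1 ?addr0 => [|p _].
    rewrite (bigD1 i) //= eqxx mul1mx big1 ?addr0 => [|p pi].
      by rewrite adj_nat mulmx1.
    by rewrite eq_sym (negPf pi) -scalemx1 scale0r !mul0mx scaler0.
  by rewrite big1 // => c _; rewrite !mul0mx scaler0.
apply: eq_bigr => k _; under eq_bigr => a _.
  rewrite sum_bath /= big1 ?add0r => [|p _]; last by rewrite !mul0mx scaler0.
  over.
rewrite exchange_big; apply: eq_bigr => l _ /=.
under eq_bigr => a _.
  under eq_bigr => c _.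
    rewrite adjZ -!scalemxAl -scalemxAr (scalerA (_%:R)) (scalerA (w _)) mulrC -scalerA.
    over.
  over.
have [->|Ukl] := eqVneq (U k l) 0.
  rewrite !mul0mx !scaler0 big1 // => a _.
  by rewrite big1 // => c _; rewrite scaler0.
(* Each copy of [k] is coupled to exactly one copy of [l]; the resulting factor [N k] equals
   [N l]. *)
under eq_bigr => a _.
  rewrite sum_copies; last by rewrite -(NU Ukl).
  rewrite eqxx scale1r.
  over.
by rewrite sumr_const card_ord (NU Ukl) scalerMnl.
Qed.

End Padding.

Lemma ad_spectrum_mem (K : fieldType) n (H X : 'M[K]_n) c :
  X != 0 -> mxbracket H X = c *: X -> ad_spectrum H c.
Proof.
move=> X0 HX; rewrite /ad_spectrum /= /passmx.leigenvalue.
apply: contra X0 => /eqP E.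
rewrite -memv0 -E /passmx.leigenspace memv_ker.
by rewrite add_lfunE opp_lfunE scale_lfunE id_lfunE lfunE /= HX subrr.
Qed.

Lemma block_channel_cvg (K : numClosedFieldType) n (Y : finType)
    (U : Y -> Y -> 'M[K]_n) (a : nat -> K) (q : nat -> Y -> K) (p : Y -> K) X i j :
  num_cvg a 0 -> (forall l, num_cvg (fun v => q v l) (p l)) ->
  num_cvg (fun v => (a v *: X + block_channel (q v) U X) i j)
          (block_channel p U X i j).
Proof.
move=> a0 qp.
have E (f : Y -> K) : block_channel f U X i j =
    \sum_k \sum_l f l * (U k l *m X *m (U k l)^t*) i j.
  rewrite summxE; apply: eq_bigr => k _; rewrite summxE.
  by apply: eq_bigr => l _; rewrite mxE.
rewrite -[block_channel p U X i j]add0r -(mul0r (X i j)) E.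
rewrite (_ : (fun v => _) = fun v => a v * X i j + block_channel (q v) U X i j).
  under eq_fun do rewrite E; apply: num_cvgD.
    by apply: num_cvgM => //; exact: num_cvg_cst.
  do 2!(apply: num_cvg_sum => ?); apply: num_cvgM => //; exact: num_cvg_cst.
by apply/funext => v; rewrite [LHS]mxE [X in X + _]mxE.
Qed.

Section Approximation.
Variable R : realType.
Local Notation C := R[i].

(** Rounding up by at most 1 leaves an error of at most [v.+1%:R^-1]. *)
Lemma num_cvg_copies (w : R) : 0 <= w ->
  num_cvg (fun v => (Num.truncn (v.+1%:R * w)).+1%:R * v.+1%:R^-1) w.
Proof.
move=> w0; apply/cvgrPdist_lt => e e0.
have /cvgrPdist_lt/(_ _ e0) := @cvg_harmonic R.
apply: filterS => v; rewrite sub0r normrN /harmonic /=.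
have v0 : 0 < v.+1%:R :> R by rewrite ltr0n.
rewrite ger0_norm ?invr_ge0 ?ltW // => ve.
rewrite distrC; apply: le_lt_trans ve.
have /truncn_itv/andP[t1 t2] : 0 <= v.+1%:R * w by rewrite mulr_ge0 // ltW.
set q := Num.truncn _ in t1 t2 *.
have -> : q.+1%:R / v.+1%:R - w = (q.+1%:R - v.+1%:R * w) / v.+1%:R.
  by rewrite mulrBl mulrAC mulfV ?mul1r // gt_eqF.
rewrite ger0_norm ?mulr_ge0 ?subr_ge0 ?invr_ge0 ?(ltW t2) ?(ltW v0) //.
by rewrite ler_piMl ?invr_ge0 ?(ltW v0) // lerBlDl -natr1 lerD2r.
Qed.

(** Divided by [v.+1%:R], the copies keep a positive limit in the partition function [Z v], while
    the fixed contribution [\sum_j e j] of the fillers dies out. *)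
Lemma weighted_copies_cvg (I : finType) m (e : I -> R) (f w : 'I_m -> R)
    (N : nat -> 'I_m -> nat) (Z := fun v => \sum_j e j + \sum_l f l *+ N v l) :
  (0 < m)%N -> (forall l, 0 < f l) -> (forall l, 0 < w l) ->
  (forall l, num_cvg (fun v => (N v l)%:R * v.+1%:R^-1) (w l)) ->
  num_cvg (fun v => (\sum_j e j) / Z v) 0 /\
  forall l, num_cvg (fun v => f l / Z v *+ N v l)
                    (f l * w l / \sum_k f k * w k).
Proof.
move=> m0 f0 w0 Nw; set L := \sum_k f k * w k.
have L0 : L != 0.
  rewrite gt_eqF // /L; case: m m0 f w N Z f0 w0 Nw L => // m _ f w N Z f0 w0 _ _.
  rewrite big_ord_recl ltr_pwDl ?mulr_gt0 // sumr_ge0 // => i _.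
  by rewrite mulr_ge0 // ltW.
have t0 : num_cvg (fun v => v.+1%:R^-1 : R) 0 by exact: cvg_harmonic.
have ZtL : num_cvg (fun v => Z v * v.+1%:R^-1) L.
  have : num_cvg (fun v => (\sum_j e j) * v.+1%:R^-1 +
      \sum_l f l * ((N v l)%:R * v.+1%:R^-1)) ((\sum_j e j) * 0 + L).
    apply: num_cvgD; first exact: (num_cvgM (@num_cvg_cst _ _) t0).
    by apply: num_cvg_sum => l; exact: (num_cvgM (@num_cvg_cst _ _) (Nw l)).
  rewrite mulr0 add0r (_ : (fun v => _) = fun v => Z v * v.+1%:R^-1) //.
  apply/funext => v; rewrite mulrDl; congr (_ + _); rewrite mulr_suml.
  by apply: eq_bigr => l _; rewrite -(mulr_natr (f l)) mulrA.
have ZL : num_cvg (fun v => (Z v * v.+1%:R^-1)^-1) L^-1 by exact: cvgV.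
have ZE (a : R) v : a / Z v = a * v.+1%:R^-1 * (Z v * v.+1%:R^-1)^-1.
  by rewrite invfM invrK [_ * v.+1%:R]mulrC mulrA -(mulrA a) mulVf ?mulr1 // pnatr_eq0.
split=> [|l].
  under eq_fun do rewrite ZE.
  have := num_cvgM (num_cvgM (@num_cvg_cst _ (\sum_j e j)) t0) ZL.
  by rewrite mulr0 mul0r.
rewrite (_ : (fun v => _) = fun v => f l * ((N v l)%:R * v.+1%:R^-1) *
    (Z v * v.+1%:R^-1)^-1); last first.
  apply/funext => v; rewrite -(mulr_natr (_ / _)) ZE mulrAC.
  by congr (_ * _); rewrite mulrAC mulrA.
exact: (num_cvgM (num_cvgM (@num_cvg_cst _ _) (Nw l)) ZL).
Qed.

Lemma TO_approx n (HS : 'M[C]_n) (T : \bar R) (r : R) : 0 < r ->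
  ad_spectrum HS `<=` [set (r * z%:~R)%:C | z in [set: int]] ->
  TO HS T `<=` @lin_closure C n (TOspin r HS T).
Proof.
move=> r0 bohr F /TO_block[m [b [m0 [U [uU cU FE]]]]].
set tau := inv_temp T in FE.
have rN0 : r != 0 by rewrite gt_eqF.
(* A nonzero block is an eigenvector of [mxbracket HS] with eigenvalue [b l - b k]. *)
have gap k l : U k l != 0 -> exists z : int, b l = b k + r * z%:~R.
  move=> /ad_spectrum_mem/(_ (cU k l))/bohr[z _].
  by rewrite -rmorphB => /complexI E; exists z; rewrite E addrC subrK.
pose fl k := Num.floor (b k / r).
pose s k := b k - r * (fl k)%:~R.
have sE k l : U k l != 0 -> s k = s l.
  (* An integer multiple of [r] shifts the floor by that integer and leaves the remainder alone. *)
  move=> /gap[z bl]; rewrite /s /fl bl mulrDl mulrAC mulfV // mul1r.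
  rewrite floorDrz ?intr_int // intrKfloor intrD mulrDr opprD addrACA.
  by rewrite subrr addr0.
(* [B] bounds every [|fl k|], so [fl k + B] is a level index between 0 and [B + B]. As index [j] has
   energy [j.+1%:R * r], the global shift is [B.+1%:R * r]. *)
pose B := (\sum_k `|fl k|)%N.
have flB k : (`|fl k| <= B)%N by rewrite /B (bigD1 k) //= leq_addr.
pose lev k : 'I_(B + B).+1 := inord `|(fl k + B%:Z)%R|%N.
have levE k : (lev k).+1%:R = (fl k)%:~R + B.+1%:R :> R.
  have fB : 0 <= fl k + B%:Z by have := flB k; lia.
  rewrite /lev inordK; last by have := flB k; lia.
  rewrite -natr1 -[B.+1%:R]natr1 addrA; congr (_ + _).
  by rewrite -[LHS]/(Posz _)%:~R (gez0_abs fB) intrD.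
(* The Boltzmann factor of the remainder is carried by the number of copies, [N v k] being about
   [v.+1%:R * w k]. *)
pose w k := expR (- tau * s k).
pose N v k := (Num.truncn (v.+1%:R * w k)).+1.
have NU v k l : U k l != 0 -> N v k = N v l.
  by move=> /sE skl; rewrite /N /w skl.
pose en (j : 'I_(B + B).+1) : R := j.+1%:R * r.
have cL : block_conserving HS ((fun j => (en j)%:C) \o lev) U.
  move=> k l; rewrite cU -!rmorphB /=.
  (* Coupled states have equal remainders, so the rounded energies differ by exactly as much as the
     original ones. *)
  have [->|/sE skl] := eqVneq (U k l) 0; first by rewrite !scaler0.
  congr (_%:C *: _); rewrite /en !levE.
  move: skl; rewrite /s => skl; lra.
pose e (j : 'I_(B + B).+1) := expR (- tau * en j).
pose Z v := \sum_j e j + \sum_l e (lev l) *+ N v l.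
have /choice[G GP] : forall v, exists G : 'End('M[C]_n), TOspin r HS T G /\
    forall X, G X = ((\sum_j e j) / Z v)%:C *: X +
      block_channel (fun l => (e (lev l) / Z v *+ N v l)%:C) U X.
  move=> v.
  (* The filler [inl j] witnesses that level [j] is occupied; the channel to realise is the padded
     block channel itself. *)
  have [G SG GE] := @block_spin_levels _ _ HS T r _ _ (pad_level (N := N v) lev)
    _ isT (fun j => ex_intro _ (inl j) erefl)
    (ex_intro _ _ (And3 (pad_unitary (NU v) uU) (pad_conserving (N := N v) cL)
      (fun X => erefl))).
  exists G; split=> // X; rewrite GE.
  rewrite -[LHS]/(block_channel
    ((fun j => (e j / _)%:C) \o pad_level (N := N v) lev) _ X).
  rewrite pad_channel; last exact: NU.
  have -> : \sum_y expR (- tau * ((pad_level (N := N v) lev y).+1%:R * r)) = Z v.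
    exact: (@pad_sum _ _ (N v) lev R e).
  congr (_ *: _ + _); first by rewrite mulr_suml rmorph_sum.
  by apply: eq_block_channel => l; rewrite rmorphMn.
apply: (@lin_closure_cvg C n _ F G) => [v|X i j]; first exact: (GP v).1.
under eq_fun do rewrite (GP _).2.
have [aL qL] := @weighted_copies_cvg _ m e (e \o lev) w N m0
  (fun l => expR_gt0 _) (fun l => expR_gt0 _) (fun l => num_cvg_copies (expR_ge0 _)).
rewrite FE (eq_block_channel (p' := fun l =>
  (e (lev l) * w l / \sum_k e (lev k) * w k)%:C)).
  apply: block_channel_cvg => [|l]; first exact: num_cvg_real aL.
  exact: num_cvg_real (qL l).
move=> l; congr (_%:C); rewrite /gibbs_weight.
(* The level weight times the copy density is the original Boltzmann factor up to the constant [c]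
   of the global shift, which cancels in the normalised quotient. *)
pose c := expR (- tau * (B.+1%:R * r)).
have c0 : c != 0 by rewrite gt_eqF // expR_gt0.
have ewE k : e (lev k) * w k = expR (- tau * b k) * c.
  rewrite /e /w /c -!expRD /en levE /s; congr expR; ring.
under [in RHS]eq_bigr do rewrite ewE.
by rewrite ewE -mulr_suml -mulf_div divff ?mulr1.
Qed.

End Approximation.

Theorem corollary6 (R : realType) (n : nat) (T : \bar R) (HS : 'M[R[i]]_n)
    (r : R) (n_gt0 : (0 < n)%N) (T_gt0 : (0 < T)%E)
    (HS_herm : HS \is hermsymmx) (r_gt0 : 0 < r)
    (bohr_r : ad_spectrum HS `<=` [set (r * z%:~R)%:C | z in [set: int]]) :
  @lin_closure R[i] n (TO HS T) = @lin_closure R[i] n (TOspin r HS T).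
Proof.
by apply: lin_closure_eq; [exact: TOspin_sub_TO | exact: TO_approx].
Qed.
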